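(* Let $\mathcal{R}$ be a commutative ring with unity, $\mathcal{A}$ a unital $\mathcal{R}$-algebra and $\mathcal{M}$ a unital $\mathcal{A}$-bimodule. Assume that $l.\mathrm{Ann}_{\mathcal{A}}(\mathcal{M})\cap r.\mathrm{Ann}_{\mathcal{A}}(\mathcal{M})=0$. Let $d:\mathcal{A}\to\mathcal{A}$ be a derivation and $S:\mathcal{M}\to\mathcal{M}$ a module generalized $d$-derivation. (1) If $S$ is inner, then $d$ is inner. Namely, if for some $a_0\in\mathcal{A}$, $S(m)=[a_0,m]$ for all $m\in\mathcal{M}$, then $d(a)=[a_0,a]$ for all $a\in\mathcal{A}$. (2) If $S$ is a bimodule homomorphism, then $d=0$. If in addition $S=[a_0,-]$ is inner, for some $a_0\in\mathcal{A}$, then $a_0$ is in the center $Z(\mathcal{A})$ of $\mathcal{A}$ (i.e., $S$ is a central inner bimodule homomorphism).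
   Context: $l.\mathrm{Ann}_{\mathcal{A}}(\mathcal{M})=\{r\in\mathcal{A}: r\mathcal{M}=0\}$ and $r.\mathrm{Ann}_{\mathcal{A}}(\mathcal{M})=\{r\in\mathcal{A}:\mathcal{M}r=0\}$. Derivations are $\mathcal{R}$-linear. For a derivation $d$ of $\mathcal{A}$, an $\mathcal{R}$-linear map $S:\mathcal{M}\to\mathcal{M}$ is a module generalized $d$-derivation if $S(am)=aS(m)+d(a)m$ and $S(ma)=S(m)a+md(a)$ for all $a\in\mathcal{A}$, $m\in\mathcal{M}$. It is inner if there is $a_0\in\mathcal{A}$ with $S(m)=[a_0,m]:=a_0m-ma_0$ for all $m\in\mathcal{M}$. A derivation $d$ of $\mathcal{A}$ is inner if $d(a)=[a_0,a]=a_0a-aa_0$ for some $a_0\in\mathcal{A}$. A bimodule homomorphism $S:\mathcal{M}\to\mathcal{M}$ is central inner if $S(m)=a_0m-ma_0$ for all $m$, for some $a_0\in Z(\mathcal{A})$. *)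

(* Defs.v *)
From HB Require Import structures.
From mathcomp Require Import all_boot all_algebra.

Set Implicit Arguments.
Unset Strict Implicit.
Unset Printing Implicit Defensive.

Import GRing.Theory.
Local Open Scope ring_scope.

Reserved Notation "a *> m" (at level 40, left associativity).
Reserved Notation "m <* a" (at level 40, left associativity).

(* An associative unital R-algebra, possibly zero.  The library's [algType R]
   imposes 1 != 0, and a structure joining [GRing.PzRing] and [GRing.Lmodule]
   can no longer be inserted below it in the hierarchy; the scaling is therefore
   a field of the mixin, and the [lmodType R] structure (hence [*:] and
   [{linear _ -> _}]) is derived from it. *)
HB.mixin Record PzRing_isPzAlgebra (R : comPzRingType) A of GRing.PzRing A := {
  pzscale : R -> A -> A;
  pzscalerA : forall (k l : R) (a : A),
    pzscale k (pzscale l a) = pzscale (k * l) a;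
  pzscale1r : left_id 1 pzscale;
  pzscalerDr : right_distributive pzscale +%R;
  pzscalerDl : forall a : A, {morph pzscale^~ a : k l / k + l};
  pzscalerAl : forall (k : R) (a b : A), pzscale k (a * b) = pzscale k a * b;
  pzscalerAr : forall (k : R) (a b : A), pzscale k (a * b) = a * pzscale k b
}.

#[short(type="pzAlgType")]
HB.structure Definition PzAlgebra (R : comPzRingType) :=
  {A of GRing.PzRing A & PzRing_isPzAlgebra R A}.

HB.instance Definition _ (R : comPzRingType) (A : pzAlgType R) :=
  GRing.Zmodule_isLmodule.Build R (PzAlgebra.sort A)
    (@pzscalerA R A) (@pzscale1r R A) (@pzscalerDr R A) (@pzscalerDl R A).

Fact algType_isPzAlgebra (R : comPzRingType) (A : algType R) :
  PzRing_isPzAlgebra R A.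
Proof.
exact: (PzRing_isPzAlgebra.Build R A (@scalerA R A) (@scale1r R A)
  (@scalerDr R A) (fun a k l => scalerDl a k l) (@scalerAl R A) (@scalerAr R A)).
Defined.

(* A unital A-bimodule.  The scaling [*:] of M is the action of the base ring
   R, so that the two actions of A, which are R-bilinear, are separate
   operations rather than [lmodType A] and [lmodType A^c] structures. *)
HB.mixin Record Lmodule_isBimodule (R : comPzRingType) (A : pzAlgType R) M
    of GRing.Lmodule R M := {
  lact : A -> M -> M;
  ract : M -> A -> M;
  lactDl : forall (a b : A) (m : M), lact (a + b) m = lact a m + lact b m;
  lactDr : forall (a : A) (m n : M), lact a (m + n) = lact a m + lact a n;
  lactZl : forall (k : R) (a : A) (m : M), lact (k *: a) m = k *: lact a m;
  lactZr : forall (k : R) (a : A) (m : M), lact a (k *: m) = k *: lact a m;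
  lactM : forall (a b : A) (m : M), lact (a * b) m = lact a (lact b m);
  lact1 : forall m : M, lact 1 m = m;
  ractDl : forall (m n : M) (a : A), ract (m + n) a = ract m a + ract n a;
  ractDr : forall (m : M) (a b : A), ract m (a + b) = ract m a + ract m b;
  ractZl : forall (k : R) (m : M) (a : A), ract (k *: m) a = k *: ract m a;
  ractZr : forall (k : R) (m : M) (a : A), ract m (k *: a) = k *: ract m a;
  ractM : forall (m : M) (a b : A), ract m (a * b) = ract (ract m a) b;
  ract1 : forall m : M, ract m 1 = m;
  lractA : forall (a : A) (m : M) (b : A),
    ract (lact a m) b = lact a (ract m b)
}.

#[short(type="bimodType")]
HB.structure Definition Bimodule (R : comPzRingType) (A : pzAlgType R) :=
  {M of GRing.Lmodule R M & Lmodule_isBimodule R A M}.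

Notation "a *> m" := (lact a m) : ring_scope.
Notation "m <* a" := (ract m a) : ring_scope.

Section Definitions.
Variables (R : comPzRingType) (A : pzAlgType R).

Definition in_center (a : A) : Prop := forall b : A, GRing.comm a b.

Definition is_derivation (d : {linear A -> A}) : Prop :=
  forall a b : A, d (a * b) = d a * b + a * d b.

Definition ad (a0 a : A) : A := a0 * a - a * a0.

Definition inner_derivation (d : {linear A -> A}) : Prop :=
  exists a0 : A, forall a : A, d a = ad a0 a.

Variable M : bimodType A.

Definition l_ann (r : A) : Prop := forall m : M, r *> m = 0.

Definition r_ann (r : A) : Prop := forall m : M, m <* r = 0.

Definition mod_gen_derivation (d : {linear A -> A}) (S : {linear M -> M}) :
    Prop :=
  (forall (a : A) (m : M), S (a *> m) = a *> S m + d a *> m)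
  /\ (forall (m : M) (a : A), S (m <* a) = S m <* a + m <* d a).

Definition mod_ad (a0 : A) (m : M) : M := a0 *> m - m <* a0.

Definition inner_mod_map (S : {linear M -> M}) : Prop :=
  exists a0 : A, forall m : M, S m = mod_ad a0 m.

Definition bimod_hom (S : {linear M -> M}) : Prop :=
  (forall (a : A) (m : M), S (a *> m) = a *> S m)
  /\ (forall (m : M) (a : A), S (m <* a) = S m <* a).

Definition central_inner_bimod_hom (S : {linear M -> M}) : Prop :=
  bimod_hom S
  /\ exists2 a0 : A, in_center a0 & forall m : M, S m = mod_ad a0 m.

End Definitions.

Arguments l_ann {R A} M r.
Arguments r_ann {R A} M r.

(* Main.v *)
Require Import Defs.
From HB Require Import structures.
From mathcomp Require Import all_boot all_algebra.

(** The annihilator hypothesis says that an element of the algebra is determined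
    by its two actions on the bimodule, and [S] records both actions of [d a]:
    they measure the failure of [S] to commute with the left and right actions
    of [a].  Hence [d a] is the only element that can play this part for [a]
    ([mod_gen_derivation_val_unique]), and each claim amounts to exhibiting
    another element that does.  When [S = mod_ad a0], the commutator [ad a0 a]
    does, by the Leibniz rules [mod_ad_lact] and [mod_ad_ract]; when [S] is a
    bimodule homomorphism, [0] does.  When both hold, [ad a0 a = d a = 0] for
    every [a], which is the centrality of [a0]. *)

Import GRing.Theory.
Local Open Scope ring_scope.

Section BimoduleLemmas.
Context {R : comPzRingType} {A : pzAlgType R} {M : bimodType A}.
Implicit Types (a b : A) (m n : M).

Lemma lactBl a b m : (a - b) *> m = a *> m - b *> m.
Proof. by apply: (canRL (addrK _)); rewrite -lactDl subrK. Qed.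

Lemma lactBr a m n : a *> (m - n) = a *> m - a *> n.
Proof. by apply: (canRL (addrK _)); rewrite -lactDr subrK. Qed.

Lemma ractBl m n a : (m - n) <* a = m <* a - n <* a.
Proof. by apply: (canRL (addrK _)); rewrite -ractDl subrK. Qed.

Lemma ractBr m a b : m <* (a - b) = m <* a - m <* b.
Proof. by apply: (canRL (addrK _)); rewrite -ractDr subrK. Qed.

Lemma lact0l m : (0 : A) *> m = 0.
Proof. by rewrite -(subrr (0 : A)) lactBl subrr. Qed.

Lemma ract0r m : m <* (0 : A) = 0.
Proof. by rewrite -(subrr (0 : A)) ractBr subrr. Qed.

(** The terms [a a0 m] on the right cancel, leaving [a0 a m - a m a0]; with
    [mod_ad_ract], it makes [mod_ad a0] a module generalized
    [ad a0]-derivation. *)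
Lemma mod_ad_lact (a0 a : A) m :
  mod_ad a0 (a *> m) = a *> mod_ad a0 m + ad a0 a *> m.
Proof.
by rewrite /mod_ad /ad lactBl lactBr !lactM lractA [RHS]addrC addrA subrK.
Qed.

Lemma mod_ad_ract (a0 a : A) m :
  mod_ad a0 (m <* a) = mod_ad a0 m <* a + m <* ad a0 a.
Proof.
by rewrite /mod_ad /ad ractBl ractBr !ractM lractA addrA subrK.
Qed.

(** The element [d a - e] annihilates [M] on both sides: subtract the two
    expressions of [S (a *> m)], and those of [S (m <* a)]. *)
Lemma mod_gen_derivation_val_unique (d : {linear A -> A}) (S : {linear M -> M})
    (a e : A) :
    (forall r : A, l_ann M r -> r_ann M r -> r = 0) ->
    mod_gen_derivation d S ->
    (forall m, S (a *> m) = a *> S m + e *> m) ->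
    (forall m, S (m <* a) = S m <* a + m <* e) ->
  d a = e.
Proof.
move=> hann [dSl dSr] eSl eSr; apply/subr0_eq/hann => m.
  by rewrite lactBl; apply/eqP; rewrite subr_eq0 -(inj_eq (addrI (a *> S m)))
    -dSl -eSl.
by rewrite ractBr; apply/eqP; rewrite subr_eq0 -(inj_eq (addrI (S m <* a)))
  -dSr -eSr.
Qed.

End BimoduleLemmas.

Theorem theorem3p8 (R : comPzRingType) (A : pzAlgType R) (M : bimodType A)
    (hann : forall r : A, l_ann M r -> r_ann M r -> r = 0)
    (d : {linear A -> A}) (hd : is_derivation d)
    (S : {linear M -> M}) (hS : mod_gen_derivation d S) :
  ((inner_mod_map S -> inner_derivation d)
   /\ (forall a0 : A, (forall m : M, S m = mod_ad a0 m) ->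
         forall a : A, d a = ad a0 a))
  /\ (bimod_hom S ->
        (forall a : A, d a = 0)
        /\ (forall a0 : A, (forall m : M, S m = mod_ad a0 m) ->
              in_center a0 /\ central_inner_bimod_hom S)).
Proof.
have d_ad a0 : (forall m, S m = mod_ad a0 m) -> forall a, d a = ad a0 a.
  move=> Sa0 a; apply: (mod_gen_derivation_val_unique _ _ _ _ hann hS) => m.
    by rewrite !Sa0 mod_ad_lact.
  by rewrite !Sa0 mod_ad_ract.
split; first by split=> // -[a0 Sa0]; exists a0; apply: d_ad.
move=> homS; have [homSl homSr] := homS.
have d0 a : d a = 0.
  apply: (mod_gen_derivation_val_unique _ _ _ _ hann hS) => m.
    by rewrite homSl lact0l addr0.
  by rewrite homSr ract0r addr0.
split=> // a0 Sa0.
have a0_central : in_center a0.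
  by move=> b; apply: subr0_eq; rewrite -[LHS](d_ad a0 Sa0 b) d0.
by split=> //; split=> //; exists a0.
Qed.
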